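(* Let $X$ be an arbitrary bounded path-connected metric space of diameter $1$, and fix a real number $\delta$ with $0<\delta<\frac12$. For $t\in[\frac12-\delta,\frac12]$ let $\mathbb{Z}_t=\bigcup_{n\in\mathbb{Z}}[n-t,n+t]\subset\mathbb{R}$ with the metric induced from $\mathbb{R}$, and for $d\in[0,\delta]$ let $\mathbb{R}_d=\mathbb{R}\times_{\ell^1}(dX)$. Note that $\mathbb{Z}_{1/2}=\mathbb{R}$ and that $\mathbb{R}_0$ is isometric to $\mathbb{R}$, so the two families can be glued at $\mathbb{R}$ into one curve $\gamma$ defined on $[-\delta,\delta]$ by $$\gamma(s)=\mathbb{Z}_{\frac12+s}\ \text{ for } s\in[-\delta,0],\qquad \gamma(s)=\mathbb{R}_s\ \text{ for } s\in[0,\delta].$$ Then (up to reparametrization) $\gamma$ is a shortest curve in the Gromov--Hausdorff class, i.e. with respect to the Gromov--Hausdorff distance $d_{GH}$, and $\mathbb{R}=\gamma(0)$ is an interior point of this curve.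
   Context: The Gromov--Hausdorff class is the (proper) class of all non-empty metric spaces, not necessarily bounded or compact, equipped with the Gromov--Hausdorff distance $d_{GH}$; spaces at zero Gromov--Hausdorff distance (in particular isometric spaces) are identified. For metric spaces $Y,Z$, $d_{GH}(Y,Z)$ is the infimum of all $r\ge 0$ such that there exist a metric space $W$ and subsets $Y',Z'\subset W$ isometric to $Y$ and $Z$ respectively with Hausdorff distance $d_H(Y',Z')\le r$. Equivalently, $2d_{GH}(Y,Z)=\inf_R \operatorname{dis} R$, where $R$ runs over all correspondences, i.e. subsets $R\subset Y\times Z$ whose projections to $Y$ and to $Z$ are both surjective, and $\operatorname{dis}R=\sup\{\,|d_Y(y,y')-d_Z(z,z')| : (y,z),(y',z')\in R\}$. The value of $d_{GH}$ may be $\infty$. For a real $d>0$, $dX$ denotes the set $X$ with the metric $d\cdot d_X$; for $d=0$, $0X$ is a one-point space. For metric spaces $Y,Z$, $Y\times_{\ell^1}Z$ is the Cartesian product with metric $d_{Y\times_{\ell^1}Z}((y,z),(y',z'))=d_Y(y,y')+d_Z(z,z')$. The real line $\mathbb{R}$ carries its natural metric $|x-y|$. A shortest curve is a continuous curve (with respect to $d_{GH}$) whose length equals the (finite) distance between its endpoints, where the length is the supremum, over finite partitions of the parameter interval, of the sums of distances between consecutive points of the curve. An interior point of the curve is one corresponding to an interior point of the parameter interval. *)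

(* Defs.v *)
From HB Require Import structures.
From mathcomp Require Import all_boot all_order all_algebra.
From mathcomp Require Import all_classical all_reals all_analysis.
Set Implicit Arguments.
Unset Strict Implicit.
Unset Printing Implicit Defensive.
Import Order.TTheory GRing.Theory Num.Theory.
Import numFieldNormedType.Exports.
Local Open Scope classical_set_scope.
Local Open Scope ring_scope.

(* MathComp-Analysis already puts the topology and the pseudometric induced
   from [X] on the coercion [set_type A]; only the distance is missing. *)
Section subset_metric.
Context {R : realType} {X : metricType R} (A : set X).

Let sdist (x y : A) : R := mdist (\val x) (\val y).

Let sdist_ge0 x y : 0 <= sdist x y.
Proof. exact: mdist_ge0. Qed.

Let sdist_positivity x y : sdist x y = 0 -> x = y.
Proof. by move=> /mdist_positivity/val_inj. Qed.

Let ballEsdist x d : ball x d = [set y | sdist x y < d].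
Proof.
have -> : ball x d = \val @^-1` (ball (\val x) d) by [].
by rewrite ballEmdist.
Qed.

HB.instance Definition _ := @PseudoMetric_isMetric.Build R (set_type A)
  sdist sdist_ge0 sdist_positivity ballEsdist.
End subset_metric.

(* An alias of the product type, since [Y * Z] itself carries the maximum
   distance in the library. *)
Definition ell1_prod (R : realType) (Y Z : metricType R) : Type := (Y * Z)%type.

Section ell1_metric.
Context {R : realType} (Y Z : metricType R).
Local Notation T := (ell1_prod Y Z).

Let pdist (p q : T) : R := mdist p.1 q.1 + mdist p.2 q.2.

Let pdistxx p : pdist p p = 0.
Proof. by rewrite /pdist !mdistxx addr0. Qed.

Let pdist_positivity p q : pdist p q = 0 -> p = q.
Proof.
case: p q => [y z] [y' z'] /eqP; rewrite /pdist /= paddr_eq0 ?mdist_ge0//.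
by move=> /andP[/eqP/mdist_positivity -> /eqP/mdist_positivity ->].
Qed.

Let pdist_sym p q : pdist p q = pdist q p.
Proof. by rewrite /pdist metric_sym [X in _ + X]metric_sym. Qed.

Let pdist_triangle q p r : pdist p r <= pdist p q + pdist q r.
Proof. by rewrite /pdist addrACA lerD// metric_triangle. Qed.

HB.instance Definition _ := Choice.copy T (Y * Z)%type.
HB.instance Definition _ := @isMetric.Build R T
  pdist pdistxx pdist_positivity pdist_sym pdist_triangle.
End ell1_metric.

Definition scaled (R : realType) (d : {posnum R}) (X : metricType R) : Type := X.

Section scaled_metric.
Context {R : realType} (d : {posnum R}) (X : metricType R).
Local Notation T := (scaled d X).

Let cdist (x y : T) : R := d%:num * mdist (x : X) (y : X).

Let cdistxx x : cdist x x = 0.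
Proof. by rewrite /cdist mdistxx mulr0. Qed.

Let cdist_positivity x y : cdist x y = 0 -> x = y.
Proof. by move=> /eqP; rewrite mulf_eq0 gt_eqF//= => /eqP/mdist_positivity. Qed.

Let cdist_sym x y : cdist x y = cdist y x.
Proof. by rewrite /cdist metric_sym. Qed.

Let cdist_triangle y x z : cdist x z <= cdist x y + cdist y z.
Proof. by rewrite /cdist -mulrDr ler_wpM2l// metric_triangle. Qed.

HB.instance Definition _ := Choice.copy T X.
HB.instance Definition _ := @isMetric.Build R T
  cdist cdistxx cdist_positivity cdist_sym cdist_triangle.
End scaled_metric.

Definition one_point (R : realType) : Type := unit.

Section one_point_metric.
Context (R : realType).
Local Notation T := (one_point R).

Let odist (x y : T) : R := 0.

Let odistxx x : odist x x = 0. Proof. by []. Qed.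

Let odist_positivity x y : odist x y = 0 -> x = y.
Proof. by case: x y => -[]. Qed.

Let odist_sym x y : odist x y = odist y x. Proof. by []. Qed.

Let odist_triangle y x z : odist x z <= odist x y + odist y z.
Proof. by rewrite /odist addr0. Qed.

HB.instance Definition _ := Choice.copy T unit.
HB.instance Definition _ := @isMetric.Build R T
  odist odistxx odist_positivity odist_sym odist_triangle.
End one_point_metric.

Section metric_notions.
Context {R : realType}.
Implicit Types X Y Z W : metricType R.

Definition isometric Y Z : Prop :=
  exists2 f : Y -> Z, set_bij setT setT f &
    forall x y, mdist (f x) (f y) = mdist x y.

Definition metric_bounded X : Prop :=
  exists M : R, forall x y : X, mdist x y <= M.

Definition diameter X : \bar R :=
  ereal_sup [set (mdist p.1 p.2)%:E | p in [set: X * X]].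

Definition path_connected (T : topologicalType) : Prop :=
  [set: T] !=set0 /\
  forall x y : T, exists f : R -> T,
    [/\ {within `[0, 1], continuous f}, f 0 = x & f 1 = y].

Definition dist_to_set W (B : set W) (w : W) : \bar R :=
  ereal_inf [set (mdist w b)%:E | b in B].

Definition hausdorff_dist W (A B : set W) : \bar R :=
  maxe (ereal_sup [set dist_to_set B a | a in A])
       (ereal_sup [set dist_to_set A b | b in B]).

(* The infimum of the empty set is [+oo], so the value may be infinite. *)
Definition dGH Y Z : \bar R :=
  ereal_inf [set r%:E | r in [set r : R | 0 <= r /\
    exists (W : metricType R) (Y' Z' : set W),
      [/\ isometric Y' Y, isometric Z' Z &
          (hausdorff_dist Y' Z' <= r%:E)%E]]].

(* The Gromov-Hausdorff class is handled without forming the quotient by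
   [dGH Y Z = 0]: its elements are represented by non-empty metric spaces, and
   the notions below see the curve only through [dGH]. A curve parametrized by
   [`[a, b]] is a function on [R] whose values outside [`[a, b]] are
   irrelevant. *)
Definition GH_curve (a b : R) (g : R -> metricType R) : Prop :=
  forall s, s \in `[a, b] ->
    [set: g s] !=set0 /\
    dGH (g s) (g u) @[u --> within [set` `[a, b]] (nbhs s)] --> 0%E.

Definition GH_variation (a b : R) (g : R -> metricType R) (p : seq R) : \bar R :=
  let F := nth b (a :: p) in
  (\sum_(0 <= i < size p) dGH (g (F i)) (g (F i.+1)))%E.

Definition GH_length (a b : R) (g : R -> metricType R) : \bar R :=
  ereal_sup [set GH_variation a b g p | p in [set p | itv_partition a b p]].

Definition shortest_GH_curve (a b : R) (g : R -> metricType R) : Prop :=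
  [/\ a <= b, GH_curve a b g, dGH (g a) (g b) \is a fin_num &
      GH_length a b g = dGH (g a) (g b)].

(* [d X], a single point for [d = 0]; negative [d] are never used. *)
Definition dilate (d : R) X : metricType R :=
  match pselect (0 < d) with
  | left d0 => scaled (PosNum d0) X
  | right _ => one_point R
  end.

Definition Zt (t : R) : set R^o :=
  \bigcup_(n in [set: int]) [set` `[n%:~R - t, n%:~R + t]].

Definition Rd X (d : R) : metricType R := ell1_prod R^o (dilate d X).

(* At [s = 0] both formulas apply; they give [Zt (1 / 2)], which is the whole
   line, and [Rd X 0], which is isometric to the line. *)
Definition gamma X (s : R) : metricType R :=
  if s <= 0 then (Zt (1 / 2 + s) : metricType R) else Rd X s.

End metric_notions.

(* Main.v *)
Require Import Defs.
From HB Require Import structures.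
From mathcomp Require Import all_boot all_order all_algebra.
From mathcomp Require Import all_classical all_reals all_analysis.
From mathcomp Require Import lra.
Import Order.TTheory GRing.Theory Num.Theory.
Import numFieldNormedType.Exports.
Local Open Scope classical_set_scope.
Local Open Scope ring_scope.
Set Implicit Arguments.
Unset Strict Implicit.
Unset Printing Implicit Defensive.

(** Put [phi s = s] for [s <= 0] and [phi s = s / 2] for [s >= 0] (this is
    [arc_length]). The curve is shortest because [phi] calibrates it:

    - [dGH (gamma s) (gamma s') <= |phi s - phi s'|] for all parameters, so that
      no partition has a variation larger than [phi delta - phi (- delta)];
    - [dGH (gamma (- delta)) (gamma delta)] is at least this number

    ([shortest_GH_curve_calibrated]).

    Upper bound ([dGH_gamma_le]). Every [gamma s] is the image of the one set
    [R * X]: send [(x, p)] to the point of [Z_t] nearest to [x] when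
    [t = 1/2 + s], [s <= 0], and to itself when [s > 0]. The distance pulled back
    to [R * X] changes by at most [2 |phi s - phi s'|] between parameters: each
    of the two nearest points moves by [|s - s'|] at most on the left half, and
    [s d_X(p, q)] moves by at most [|s - s'|] on the right half, as [X] has
    diameter 1. Two surjections from a common set with distortion [2 r] bound
    [dGH] by [r], by gluing the two spaces along them ([dGH_le_distortion]).

    Lower bound ([dGH_gamma_ge], [distortion_to_Zt]). If [dGH] is less than [r],
    there is a map [f] from the line times [dX] to [Z_t] that changes distances
    by at most [c = 2 r]. Up to reflection of [Z_t], [f] increases at large scale
    ([rough_isometry_monotone]). So along each line [R x {p}] the map has to jump
    over the [n]-th gap of [Z_t], of length [1 - 2 t], at some abscissa [x_n(p)]
    ([crossing]). For [n] far below [m] and any [p, q], comparing points just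
    before and just after the two jumps gives
<<
      | x_m(q) - x_n(p) + d d_X(p, q) - (m - n) | <= e,   e = c - (1 - 2 t),
>>
    because the outer two images are at least [m - n + (1 - 2 t)] apart and the
    inner two at most [m - n - (1 - 2 t)], while their sources have almost the
    same distance ([crossing_gap]). Now go from [p] to [q], back to [p], and so
    on, crossing farther and farther gaps: each step costs at most [e - d d_X(p, q)]
    relative to the drift [m - n]. If [e < d d_X(p, q)], then [x_n(p) - n] tends
    to minus infinity, whereas the estimate with [p = q] keeps it bounded. Hence
    [c >= 1 - 2 t + d d_X(p, q)] ([crossing_distance]), and [d_X(p, q)] is as
    close to 1 as one likes. *)

(** * Real functions that are isometries up to a bounded error *)

Ltac abs_lra :=
  repeat match goal with |- context [`|?x|] => case: (ger0P x) => ? end; lra.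

(** If for instance [f w] lay between [f u] and [f v], then [|f u - f v|] would be
    the sum of its distances to the two others, so it would exceed [|a u - a v|]
    by at least [2 |a v - a w| - 2 C], which is more than [C]. *)
Lemma rough_isometry_between (R : realFieldType) (T : Type) (a f : T -> R)
    (C : R) (rough : forall u v, `| `|f u - f v| - `|a u - a v| | <= C)
    (u v w : T) :
  a u + 2 * C < a v -> a v + 2 * C < a w ->
  f u < f v < f w \/ f w < f v < f u.
Proof.
move=> uv vw.
have C0 : 0 <= C by apply: le_trans (rough u u).
move: (rough u v) (rough v w) (rough u w); rewrite !ler_distl => ruv rvw ruw.
have [|not_incr] := boolP (f u < f v < f w); first by left.
have [|not_decr] := boolP (f w < f v < f u); first by right.
exfalso; move: ruv rvw ruw not_incr not_decr.
rewrite !negb_and -!leNgt.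
abs_lra.
Qed.

(** Two pairs are compared through a far left and a far right point, which
    enclose both. *)
Lemma rough_isometry_monotone (R : realFieldType) (T : Type) (a f : T -> R)
    (C : R) (rough : forall u v, `| `|f u - f v| - `|a u - a v| | <= C)
    (a_surj : forall x, exists u, a u = x) :
  (forall u v, a u + 2 * C < a v -> f u < f v) \/
  (forall u v, a u + 2 * C < a v -> f v < f u).
Proof.
have between := @rough_isometry_between _ _ _ _ _ rough.
have [u0 au0] := a_surj 0.
have [v0 av0] := a_surj (2 * C + 1).
have C0 : 0 <= C by apply: le_trans (rough u0 u0).
have key u v : a u + 2 * C < a v -> (f u < f v) = (f u0 < f v0).
  move=> uv.
  have [w aw] := a_surj (Num.min (a u) 0 - 2 * C - 1).
  have [z az] := a_surj (Num.max (a v) (a v0) + 2 * C + 1).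
  have [/between wu /between w0] : a w + 2 * C < a u /\ a w + 2 * C < a u0.
    by rewrite aw au0; split; case: (leP (a u) 0) => ?; lra.
  have [/between vz /between v0z] : a v + 2 * C < a z /\ a v0 + 2 * C < a z.
    by rewrite az; split; case: (leP (a v)) => ?; lra.
  have u0v0 : a u0 + 2 * C < a v0 by rewrite au0 av0; lra.
  have uz : a u + 2 * C < a z by rewrite az; case: (leP (a v)) => ?; lra.
  have u0z : a u0 + 2 * C < a z by rewrite az av0 au0; case: (leP (a v)) => ?; lra.
  move: (wu _ uv) (w0 _ u0v0) (wu _ uz) (w0 _ u0z).
  have [fuv|fuv] := boolP (f u < f v); have [f0|f0] := boolP (f u0 < f v0) => //;
    move: fuv f0; lra.
have [f0|f0] := ltP (f u0) (f v0); [left|right] => u v uv; move: (key u v uv).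
  by rewrite f0 => ->.
rewrite [RHS]ltNge f0 /= => /negbT; rewrite -leNgt => fvu.
have [w aw] := a_surj (a v + 2 * C + 1).
have vw : a v + 2 * C < a w by rewrite aw; lra.
by case: (between u v w uv vw); lra.
Qed.

(** * Crossing the gaps along the lines of a product *)

Section crossings.
Context {R : realType} {X : Type} (rho : X -> X -> R) (D c t : R)
  (f : R * X -> R).
Hypothesis rho_ge0 : forall p q, 0 <= rho p q.
Hypothesis rho_le : forall p q, rho p q <= D.
Hypothesis distortion : forall u v,
  `| `|f u - f v| - (`|u.1 - v.1| + rho u.2 v.2) | <= c.
Hypothesis jump : forall u (n : nat), f u <= n%:R + t \/ n%:R + 1 - t <= f u.
Let C := c + D.
Hypothesis increasing : forall u v, u.1 + 2 * C < v.1 -> f u < f v.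

Let c_ge0 (p : X) : 0 <= c.
Proof. exact: le_trans (distortion (0, p) (0, p)). Qed.

Let D_ge0 (p : X) : 0 <= D.
Proof. exact: le_trans (rho_le p p). Qed.

Definition crossing (n : nat) (p : X) : R :=
  sup [set x | f (x, p) <= n%:R + t].

Let far_growth u v : u.1 + 2 * C < v.1 ->
  v.1 - u.1 - c <= f v - f u <= v.1 - u.1 + C.
Proof.
move=> uv; have fuv := increasing uv; rewrite /C in uv *.
have c0 := c_ge0 u.2; have D0 := D_ge0 u.2.
have r0 := rho_ge0 v.2 u.2; have r1 := rho_le v.2 u.2.
have := distortion v u; rewrite ler_distl.
rewrite (@gtr0_norm _ (f v - f u)) ?subr_gt0// (@gtr0_norm _ (v.1 - u.1)); lra.
Qed.

Lemma crossing_has_sup n p : has_sup [set x | f (x, p) <= n%:R + t].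
Proof.
have c0 := c_ge0 p; have D0 := D_ge0 p.
split.
  (* far enough to the left for [far_growth] to apply between [x] and [0], and to
     bring [f] below the gap *)
  pose x := - (2 * C + 1 + c + `|f (0, p)| + `|n%:R + t|).
  exists x; have := @far_growth (x, p) (0, p).
  rewrite /= /x /C.
  have := ler_norm (f (0, p)); have := ler_norm (- (n%:R + t)); rewrite normrN.
  have := normr_ge0 (f (0, p)); have := normr_ge0 (n%:R + t).
  move=> ? ? ? ? /(_ _) H.
  have := H ltac:(lra); lra.
exists (2 * C + 1 + c + `|f (0, p)| + `|n%:R + t|) => x /= fx.
rewrite leNgt; apply/negP => xbig.
have := @far_growth (0, p) (x, p); move: xbig; rewrite /= /C.
have := ler_norm (- f (0, p)); have := ler_norm (n%:R + t); rewrite normrN.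
have := normr_ge0 (f (0, p)); have := normr_ge0 (n%:R + t).
move=> ? ? ? ? ? /(_ _) H.
have := H ltac:(lra); lra.
Qed.

Lemma crossing_before n p eta : 0 < eta ->
  exists2 x, crossing n p - eta < x <= crossing n p & f (x, p) <= n%:R + t.
Proof.
move=> eta0; have hs := crossing_has_sup n p.
have [x fx xgt] := sup_adherent eta0 hs.
by exists x => //; apply/andP; split => //; apply: ub_le_sup => //; case: hs.
Qed.

Lemma crossing_after n p x : crossing n p < x -> n%:R + 1 - t <= f (x, p).
Proof.
move=> xgt; case: (jump (x, p) n) => // fx.
have : x <= crossing n p by apply: ub_le_sup => //; case: (crossing_has_sup n p).
by rewrite leNgt xgt.
Qed.

(** The sources of the outer points [un], [vm] and of the inner points [vn], [um]
    are, up to [eta], at the same distance, namely the quantity to be estimated;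
    their images are [m - n + (1 - 2 t)] apart at least, resp. [m - n - (1 - 2 t)]
    at most. The hypothesis on [m - n] makes the large-scale monotonicity of [f]
    decide all the signs. *)
Lemma crossing_gap n m p q : t <= 1 / 2 -> 4 * C + 2 <= m%:R - n%:R ->
  `| crossing m q - crossing n p + rho p q - (m%:R - n%:R) | <= c - (1 - 2 * t).
Proof.
move=> t_le far; have c0 := c_ge0 p; have D0 := D_ge0 p.
have CE : C = c + D by [].
suff approx eta : 0 < eta -> eta < 1 / 4 ->
    `| crossing m q - crossing n p + rho p q - (m%:R - n%:R) |
      <= c - (1 - 2 * t) + 2 * eta.
  apply/ler_addgt0Pr => e e0; pose eta := Num.min (e / 2) (1 / 8).
  have : 0 < eta /\ eta < 1 / 4 /\ 2 * eta <= e.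
    by rewrite /eta; case: (leP (e / 2)) => ?; lra.
  move=> [eta0 [eta1 eta2]]; apply: le_trans (approx _ eta0 eta1) _; lra.
move=> eta0 eta1.
have [un /andP[un1 un2] fun_] := crossing_before n p eta0.
have [um /andP[um1 um2] fum] := crossing_before m q eta0.
have := @crossing_after n p (crossing n p + eta) ltac:(lra).
have := @crossing_after m q (crossing m q + eta) ltac:(lra).
set vm := crossing m q + eta; set vn := crossing n p + eta => fvm fvn.
have := rho_le p q; have := rho_ge0 p q => r0 r1.
(* [f] rises by more than [4 C] from [un] to [vm]: too much for two points at
   distance at most [2 C], and in the wrong direction if [vm] is far left. *)
have vmun : un + 2 * C < vm.
  rewrite ltNge; apply/negP => vm_le.
  have := distortion (un, p) (vm, q); rewrite /= ler_distl.
  have [?|?] := ltP (vm + 2 * C) un.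
    have : f (vm, q) < f (un, p) by apply: increasing.
    lra.
  abs_lra.
have := @far_growth (un, p) (vm, q) vmun => /= gr.
have := distortion (un, p) (vm, q); rewrite /= ler_distl => d1.
have := distortion (vn, p) (um, q); rewrite /= ler_distl => d2.
have vnum : vn + 2 * C < um.
  rewrite /vm /vn in fvm fvn gr *; lra.
have := @far_growth (vn, p) (um, q) vnum => /= gr'.
rewrite ler_distl.
move: d1 d2; rewrite !(distrC _ (f (_, q))) !(distrC _ vm) !(distrC _ um).
rewrite !(@gtr0_norm _ (_ - _)); [|lra ..].
rewrite /vm /vn in fvm fvn gr *; lra.
Qed.

(** Otherwise, alternating between [p] and [q] lets [crossing n p - n] decrease
    by a fixed amount every [2 K] gaps, although [crossing_gap] with [p = q]
    bounds it below. *)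
Lemma crossing_distance p q : t <= 1 / 2 -> rho p q = rho q p ->
  rho p q <= c - (1 - 2 * t).
Proof.
move=> t_le rhoC; set e := c - (1 - 2 * t).
have [K farK] : exists K : nat, 4 * C + 2 <= K%:R.
  exists (Num.bound `|4 * C + 2|).
  by rewrite ltW// (le_lt_trans (ler_norm _))// archi_boundP.
have C0 : 0 <= C by rewrite addr_ge0// ?c_ge0 ?D_ge0.
have far (n k : nat) : (0 < k)%N -> 4 * C + 2 <= (n + k * K)%:R - n%:R.
  move=> k0; rewrite natrD addrAC subrr add0r natrM (le_trans farK)//.
  by rewrite ler_peMl// ler1n.
have step n : crossing (n + 2 * K) p
    <= crossing n p + (2 * K)%:R + 2 * (e - rho p q).
  have := crossing_gap p q t_le (far n 1 isT).
  have := crossing_gap q p t_le (far (n + 1 * K)%N 1 isT).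
  rewrite !ler_distl -rhoC -/e !mul1n -addnA addnn -mul2n !natrD.
  lra.
have steps j : crossing (j * (2 * K)) p
    <= crossing 0 p + (j * (2 * K))%:R + 2 * (e - rho p q) * j%:R.
  elim: j => [|j IH]; first by rewrite mul0n mulr0 !addr0.
  rewrite mulSn addnC; apply: le_trans (step _) _; move: IH.
  rewrite -natr1 natrD; lra.
rewrite leNgt; apply/negP => e_lt.
have gap0 : 0 < 2 * (rho p q - e) by lra.
(* [rho p p] is only known to be at most [D], hence [e + D] instead of [e] *)
pose j := Num.bound (`|e + D| / (2 * (rho p q - e))).
have : `|e + D| < 2 * (rho p q - e) * j%:R.
  by rewrite mulrC -ltr_pdivrMr// archi_boundP// divr_ge0// ltW.
have := crossing_gap p p t_le (far 0%N (j.+1 * 2)%N isT).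
have := steps j.+1; rewrite add0n -mulnA ler_distl.
have := rho_le p p; have := ler_norm (e + D).
by rewrite -/e subr0 -[in _%:R * _]natr1; lra.
Qed.
End crossings.

(** * Maps from a product with the line to [Zt t] *)

Lemma Zt_gaps (R : realType) (t y : R) (n : int) : Zt t y ->
  y <= n%:~R + t \/ n%:~R + 1 - t <= y.
Proof.
move=> [k _] /=; rewrite in_itv /= => /andP[y1 y2].
have [kn|nk] := leP k n; [left|right].
  by apply: le_trans y2 _; rewrite lerD2r ler_int.
apply: le_trans y1; rewrite lerD2r -[1]/(1%:~R) -intrD ler_int.
by rewrite lezD1.
Qed.

Lemma Zt_opp (R : realType) (t y : R) : Zt t y -> Zt t (- y).
Proof.
move=> [k _] /=; rewrite in_itv /= => /andP[y1 y2].
exists (- k) => //=; rewrite in_itv /= mulrNz; lra.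
Qed.

(** When [f] decreases at large scale, [- f] increases, and [Zt t] is symmetric. *)
Lemma distortion_to_Zt (R : realType) (X : Type) (rho : X -> X -> R)
    (D c t : R) (f : R * X -> R) (p q : X) :
  (forall p q, 0 <= rho p q) -> (forall p q, rho p q <= D) ->
  rho p q = rho q p -> t <= 1 / 2 ->
  (forall u, Zt t (f u)) ->
  (forall u v, `| `|f u - f v| - (`|u.1 - v.1| + rho u.2 v.2)| <= c) ->
  rho p q + (1 - 2 * t) <= c.
Proof.
move=> r0 rD rC t_le fZ dis; rewrite -lerBrDr.
have rough u v : `| `|f u - f v| - `|u.1 - v.1| | <= c + D.
  move: (dis u v) (r0 u.2 v.2) (rD u.2 v.2); rewrite !ler_distl; lra.
have a_surj (x : R) : exists u : R * X, u.1 = x by exists (x, p).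
have [incr|decr] := rough_isometry_monotone rough a_surj.
  apply: crossing_distance r0 rD dis _ incr p q t_le rC => u n.
  exact: (Zt_gaps n (fZ u)).
apply: (crossing_distance (f := fun u => - f u)) r0 rD _ _ _ p q t_le rC.
- by move=> u v; rewrite -opprD normrN dis.
- by move=> u n; exact: (Zt_gaps n (Zt_opp (fZ u))).
- by move=> u v uv; rewrite ltrN2 decr.
Qed.

(** * Gluing two metric spaces *)

(** Besides positivity, the hypotheses are the triangle inequalities that involve
    points of both spaces. *)
Section glued_metric.
Context {R : realType} {Y Z : metricType R} (cross : Y -> Z -> R).
Hypothesis cross_gt0 : forall y z, 0 < cross y z.
Hypothesis crossl : forall y y' z, cross y z <= mdist y y' + cross y' z.
Hypothesis crossr : forall y z z', cross y z <= cross y z' + mdist z' z.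
Hypothesis distl : forall y y' z, mdist y y' <= cross y z + cross y' z.
Hypothesis distr : forall y z z', mdist z z' <= cross y z + cross y z'.

Definition glued_dist (u v : Y + Z) : R :=
  match u, v with
  | inl y, inl y' => mdist y y'
  | inr z, inr z' => mdist z z'
  | inl y, inr z | inr z, inl y => cross y z
  end.

Let glued_dist_eq0 u v : glued_dist u v = 0 -> u = v.
Proof.
case: u v => [y|z] [y'|z'] /= => [/mdist_positivity -> //|||/mdist_positivity -> //];
  by move/eqP; rewrite gt_eqF.
Qed.

Let glued_dist_sym u v : glued_dist u v = glued_dist v u.
Proof. by case: u v => [y|z] [y'|z'] //=; apply: metric_sym. Qed.

Let glued_dist_triangle v u w :
  glued_dist u w <= glued_dist u v + glued_dist v w.
Proof.
case: u v w => [y1|z1] [y2|z2] [y3|z3] //=; rewrite ?metric_triangle//.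
- by rewrite addrC (metric_sym y2) crossl.
- by rewrite addrC (metric_sym z1) crossr.
Qed.

Let glued_distxx u : glued_dist u u = 0.
Proof. by case: u => u /=; rewrite mdistxx. Qed.

Definition glued_space : metricType R :=
  HB.pack (Y + Z)%type
    (isMetric.Build R (Y + Z)%type glued_distxx glued_dist_eq0
       glued_dist_sym glued_dist_triangle).

Lemma glued_mdist (u v : glued_space) : mdist u v = glued_dist u v.
Proof. by []. Qed.
End glued_metric.

(** * The Gromov-Hausdorff distance and distortion *)

Lemma isometric_sym (R : realType) (Y Z : metricType R) :
  isometric Y Z -> isometric Z Y.
Proof.
move=> [f [_ f_inj f_surj] iso].
have inv z : exists y, f y = z by have [y _ <-] := f_surj z I; exists y.
have [g gE] := choice inv.
exists g => [|z z']; last by rewrite -iso !gE.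
split => // [z z' _ _ gzz'|y _]; first by rewrite -(gE z) gzz' gE.
by exists (f y) => //; apply: f_inj; rewrite ?inE// gE.
Qed.

Lemma isometric_range (R : realType) (Y W : metricType R) (i : Y -> W) :
  (forall y y', mdist (i y) (i y') = mdist y y') -> isometric (range i) Y.
Proof.
move=> iso; have inv (w : range i) : exists y, i y = val w.
  by have /set_mem[y _ <-] := valP w; exists y.
have [g gE] := choice inv.
exists g => [|v w]; last by rewrite -iso !gE.
split => // [v w _ _ gvw|y _].
  by apply: val_inj; rewrite -!gE gvw.
have iy : i y \in range i by rewrite inE; exists y.
exists (exist (fun w => w \in range i) (i y) iy) => //.
by apply: mdist_positivity; rewrite -iso gE mdistxx.
Qed.

Section parametrized_correspondence.
Context {R : realType} {Y Z : metricType R} {T : Type} (al : T -> Y) (be : T -> Z).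

(** The length of a shortest path from [y] to [z] when bridges of length [r]
    join [al t] to [be t]. *)
Definition cross_dist (r : R) (y : Y) (z : Z) : R :=
  inf [set mdist y (al t) + mdist (be t) z | t in [set: T]] + r.

Context (t0 : T) (r : R) (r_gt0 : 0 < r).
Hypothesis distortion : forall s t,
  `|mdist (al s) (al t) - mdist (be s) (be t)| <= 2 * r.

Let has_inf_cross y z :
  has_inf [set mdist y (al t) + mdist (be t) z | t in [set: T]].
Proof.
split; first by exists (mdist y (al t0) + mdist (be t0) z); exists t0.
by exists 0 => _ [t _ <-]; rewrite addr_ge0// mdist_ge0.
Qed.

Let cross_dist_le t y z :
  cross_dist r y z <= mdist y (al t) + mdist (be t) z + r.
Proof.
by rewrite lerD2r; apply: ge_inf; [case: (has_inf_cross y z)|exists t].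
Qed.

Let cross_dist_ge x y z :
  (forall t, x <= mdist y (al t) + mdist (be t) z + r) -> x <= cross_dist r y z.
Proof.
move=> H; rewrite -lerBlDr; apply: lb_le_inf; first by case: (has_inf_cross y z).
by move=> _ [t _ <-]; rewrite lerBlDr.
Qed.

(** Going over a bridge and back by another one cannot shorten distances, since
    the two bridges together have length [2 r], the distortion. Positivity of [r]
    keeps the two spaces disjoint in the glued one. *)
Lemma dGH_le_distortion_pos : (forall y, exists t, al t = y) ->
  (forall z, exists t, be t = z) -> (dGH Y Z <= r%:E)%E.
Proof.
move=> al_surj be_surj.
have cross_gt0 y z : 0 < cross_dist r y z.
  apply: lt_le_trans r_gt0 _; apply: cross_dist_ge => t.
  by rewrite lerDr addr_ge0// mdist_ge0.
have crossl y y' z : cross_dist r y z <= mdist y y' + cross_dist r y' z.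
  rewrite -lerBlDl; apply: cross_dist_ge => t; rewrite lerBlDl.
  apply: le_trans (cross_dist_le t y z) _.
  by rewrite !addrA !lerD2r metric_triangle.
have crossr y z z' : cross_dist r y z <= cross_dist r y z' + mdist z' z.
  rewrite -lerBlDr; apply: cross_dist_ge => t; rewrite lerBlDr.
  apply: le_trans (cross_dist_le t y z) _.
  by have := metric_triangle (be t) z' z; lra.
have distl y y' z : mdist y y' <= cross_dist r y z + cross_dist r y' z.
  rewrite -lerBlDl; apply: cross_dist_ge => t; rewrite lerBlDl.
  rewrite -lerBlDr; apply: cross_dist_ge => s; rewrite lerBlDr.
  have := distortion s t; rewrite ler_distl.
  have := metric_triangle y (al s) y'; have := metric_triangle (al s) (al t) y'.
  have := metric_triangle (be s) z (be t).
  by rewrite (metric_sym y' (al t)) (metric_sym z (be t)); lra.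
have distr y z z' : mdist z z' <= cross_dist r y z + cross_dist r y z'.
  rewrite -lerBlDl; apply: cross_dist_ge => t; rewrite lerBlDl.
  rewrite -lerBlDr; apply: cross_dist_ge => s; rewrite lerBlDr.
  have := distortion s t; rewrite ler_distl.
  have := metric_triangle z (be s) z'; have := metric_triangle (be s) (be t) z'.
  have := metric_triangle (al s) y (al t).
  by rewrite (metric_sym (al s) y) (metric_sym z (be s)); lra.
pose W := glued_space cross_gt0 crossl crossr distl distr.
have cross_al t : cross_dist r (al t) (be t) <= r.
  by apply: le_trans (cross_dist_le t _ _) _; rewrite !mdistxx !add0r.
apply: ereal_inf_lbound; exists r => //; split; first exact: ltW.
exists W, (range (inl : Y -> W)), (range (inr : Z -> W)); split.
- exact: isometric_range.
- exact: isometric_range.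
rewrite /hausdorff_dist ge_max; apply/andP; split; apply: ge_ereal_sup.
  move=> _ [_ [y _ <-] <-]; have [t <-] := al_surj y.
  apply: (@le_trans _ _ (mdist (inl (al t) : W) (inr (be t)))%:E).
    by apply: ereal_inf_lbound; exists (inr (be t)) => //; exists (be t).
  by rewrite lee_fin glued_mdist/= cross_al.
move=> _ [_ [z _ <-] <-]; have [t <-] := be_surj z.
apply: (@le_trans _ _ (mdist (inr (be t) : W) (inl (al t)))%:E).
  by apply: ereal_inf_lbound; exists (inl (al t)) => //; exists (al t).
by rewrite lee_fin glued_mdist/= cross_al.
Qed.
End parametrized_correspondence.

Lemma dGH_le_distortion (R : realType) (Y Z : metricType R) (T : Type)
    (al : T -> Y) (be : T -> Z) (t0 : T) (r : R) : 0 <= r ->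
  (forall s t, `|mdist (al s) (al t) - mdist (be s) (be t)| <= 2 * r) ->
  (forall y, exists t, al t = y) -> (forall z, exists t, be t = z) ->
  (dGH Y Z <= r%:E)%E.
Proof.
move=> r0 dis al_surj be_surj; apply/lee_addgt0Pr => e e0; rewrite -EFinD.
apply: (dGH_le_distortion_pos t0 _ _ al_surj be_surj) => [|s t]; first by lra.
by apply: le_trans (dis s t) _; lra.
Qed.

(** A point of [Z] goes to a point of [Y] at distance less than [r] in a common
    ambient space. *)
Lemma dGH_lt_map (R : realType) (Y Z : metricType R) (r : R) :
  (dGH Y Z < r%:E)%E ->
  exists f : Z -> Y, forall z z',
    `|mdist (f z) (f z') - mdist z z'| <= 2 * r.
Proof.
move=> /ereal_inf_lt[_ [r' [r'0 [W [Y' [Z' [[i _ iE] isoZ haus]]]]]] <-].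
rewrite lte_fin => r'r; have [j _ jE] := isometric_sym isoZ.
have near z : exists y : Y', mdist (val (j z)) (val y) < r.
  have : (dist_to_set Y' (val (j z)) < r%:E)%E.
    apply: le_lt_trans (_ : (r'%:E < _)%E); last by rewrite lte_fin.
    apply: le_trans haus; rewrite /hausdorff_dist le_max; apply/orP; right.
    apply: ereal_sup_ubound; exists (val (j z)) => //.
    exact: set_mem (valP (j z)).
  move=> /ereal_inf_lt[_ [w /mem_set Y'w <-]]; rewrite lte_fin => lt.
  by exists (exist (fun w => w \in Y') w Y'w).
have [g gE] := choice near.
exists (i \o g) => z z'; rewrite /= iE -jE ler_distl.
change (mdist (g z) (g z')) with (mdist (val (g z)) (val (g z'))).
change (mdist (j z) (j z')) with (mdist (val (j z)) (val (j z'))).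
move: (gE z) (gE z'); move: (val (j z)) (val (j z')) (val (g z)) (val (g z')).
move=> a a' b b' ab ab'.
have := metric_triangle a b a'; have := metric_triangle b b' a'.
have := metric_triangle b a b'; have := metric_triangle a a' b'.
rewrite (metric_sym b a) (metric_sym b' a'); lra.
Qed.

(** * The curve in coordinates *)

(** The point of [Zt t] nearest to [x]: clipping to [[n - t, n + t]], where [n] is
    the integer nearest to [x]. The choice of [n] does not depend on [t], which
    makes [snap] Lipschitz in [t]. *)
Definition snap (R : realType) (t x : R) : R :=
  let n : R := (Num.floor (x + 1 / 2))%:~R in
  n + Num.max (- t) (Num.min t (x - n)).

Lemma snap_in_Zt (R : realType) (t x : R) : 0 <= t -> Zt t (snap t x).
Proof.
move=> t0; exists (Num.floor (x + 1 / 2)) => //=; rewrite in_itv /= /snap.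
set n := _%:~R; case: (leP t (x - n)) => ?; last case: (leP (- t)) => ?;
  rewrite ?max_r; lra.
Qed.

(** For [t = 1 / 2], a half-integer [a] belongs to two intervals, and rounding may
    pick the integer above it instead of [k]; then [a] is an end of the chosen
    interval. *)
Lemma snap_id (R : realType) (t a : R) : 0 <= t <= 1 / 2 -> Zt t a ->
  snap t a = a.
Proof.
move=> t01 [k _] /=; rewrite in_itv /= /snap => ak.
have := floor_itv (a + 1 / 2); rewrite intrD.
set n := Num.floor _ => an.
suff : - t <= a - n%:~R <= t.
  move=> {}an; rewrite min_r ?max_r; lra.
have [nk|kn|->//] := ltgtP n k; last by lra.
  have : n%:~R + 1 <= k%:~R :> R by rewrite -[1]/(1%:~R) -intrD ler_int lezD1.
  lra.
have : k%:~R + 1 <= n%:~R :> R by rewrite -[1]/(1%:~R) -intrD ler_int lezD1.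
lra.
Qed.

Lemma Zt_half (R : realType) : Zt (1 / 2 : R) = [set: R^o].
Proof.
apply/seteqP; split => // x _; exists (Num.floor (x + 1 / 2)) => //=.
have := floor_itv (x + 1 / 2); rewrite in_itv/= intrD; lra.
Qed.

Lemma snap_half (R : realType) (x : R) : snap (1 / 2) x = x.
Proof. by apply: snap_id; [lra|rewrite Zt_half]. Qed.

Lemma snap_lip (R : realType) (t t' x : R) : t <= t' ->
  `|snap t x - snap t' x| <= t' - t.
Proof.
move=> tt'; rewrite /snap; set n := _%:~R; rewrite opprD addrACA subrr add0r.
rewrite ler_distl.
by case: (leP t (x - n)) => ?; case: (leP t' (x - n)) => ?;
  case: (leP (- t)) => ?; case: (leP (- t')) => ?; lra.
Qed.

Section gamma_charts.
Context {R : realType} (X : metricType R).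

(** The distance of [gamma X s] pulled back to [R * X]. *)
Definition chart_dist (s : R) (u v : R * X) : R :=
  if s <= 0 then `|snap (1 / 2 + s) u.1 - snap (1 / 2 + s) v.1|
  else `|u.1 - v.1| + s * mdist u.2 v.2.

(** The calibration [phi], normalised to vanish at the real line. *)
Definition arc_length (s : R) : R := if s <= 0 then s else s / 2.

Lemma mdist_real (x y : R) : mdist (x : R^o) (y : R^o) = `|x - y|.
Proof. by rewrite distrC. Qed.

Lemma gamma_nonpos_embedding (s : R) : s <= 0 ->
  exists2 i : gamma X s -> R, (forall x y, `|i x - i y| = mdist x y) &
    (forall x, Zt (1 / 2 + s) (i x)) /\
    (forall y, Zt (1 / 2 + s) y -> exists x, i x = y).
Proof.
move=> s0; rewrite /gamma s0; exists (fun x => val x).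
  by move=> x y; rewrite -mdist_real.
split => [x|y /mem_set Zy]; first exact: set_mem (valP x).
by exists (exist (fun y => y \in Zt (1 / 2 + s)) y Zy).
Qed.

Lemma gamma_pos_chart (s : R) : 0 < s ->
  exists2 al : R * X -> gamma X s,
    (forall u v, mdist (al u) (al v) = `|u.1 - v.1| + s * mdist u.2 v.2) &
    forall y, exists u, al u = y.
Proof.
move=> s0; rewrite /gamma leNgt s0 /= /Rd /dilate; case: pselect => // s0'.
exists (fun u => u) => [u v|y]; last by exists y.
by rewrite -mdist_real.
Qed.

Lemma gamma_chart (p0 : X) (s : R) : - (1 / 2) <= s ->
  exists2 al : R * X -> gamma X s,
    (forall u v, mdist (al u) (al v) = chart_dist s u v) &
    forall y, exists u, al u = y.
Proof.
move=> s_ge; rewrite /chart_dist; case: (leP s 0) => s0; last first.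
  exact: gamma_pos_chart.
have [i iE [iZ i_surj]] := gamma_nonpos_embedding s0.
have snapped (u : R * X) : exists x, i x = snap (1 / 2 + s) u.1.
  by apply: i_surj; apply: snap_in_Zt; lra.
have [al alE] := choice snapped.
exists al => [u v|y]; first by rewrite -iE !alE.
exists (i y, p0); apply: mdist_positivity; rewrite -iE alE /=.
by rewrite snap_id ?subrr ?normr0//; lra.
Qed.

Hypothesis diam_le1 : forall p q : X, mdist p q <= 1.

Let chart_dist0 u v : chart_dist 0 u v = `|u.1 - v.1|.
Proof. by rewrite /chart_dist lexx addr0 !snap_half. Qed.

Let chart_dist_nonpos s s' u v : s <= s' -> s' <= 0 ->
  `|chart_dist s u v - chart_dist s' u v| <= 2 * (s' - s).
Proof.
move=> ss' s'0; have s0 := le_trans ss' s'0; rewrite /chart_dist s0 s'0 /=.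
have tt' : 1 / 2 + s <= 1 / 2 + s' by lra.
have := snap_lip u.1 tt'; have := snap_lip v.1 tt'; rewrite !ler_distl.
abs_lra.
Qed.

Let chart_dist_nonneg s s' u v : 0 <= s -> s <= s' ->
  `|chart_dist s u v - chart_dist s' u v| <= s' - s.
Proof.
have E r : 0 <= r -> chart_dist r u v = `|u.1 - v.1| + r * mdist u.2 v.2.
  rewrite le_eqVlt => /orP[/eqP <-|r0]; first by rewrite mul0r addr0 chart_dist0.
  by rewrite /chart_dist leNgt r0.
move=> s0 ss'; rewrite !E//; last exact: le_trans ss'.
rewrite ler_distl; have := mdist_ge0 u.2 v.2; have := diam_le1 u.2 v.2.
nra.
Qed.

(** When [s <= 0 <= s'], the two halves of the curve are compared at the parameter
    [0], where both formulas for the distance give [|u.1 - v.1|]. *)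
Lemma chart_dist_lip s s' u v : s <= s' ->
  `|chart_dist s u v - chart_dist s' u v| <= 2 * (arc_length s' - arc_length s).
Proof.
move=> ss'; rewrite /arc_length; case: (leP s' 0) => s'0.
  by rewrite (le_trans ss' s'0) chart_dist_nonpos.
case: (leP s 0) => s0; last first.
  by apply: le_trans (chart_dist_nonneg _ _ (ltW s0) ss') _; lra.
have := chart_dist_nonpos u v s0 (lexx 0).
have := chart_dist_nonneg u v (lexx 0) (ltW s'0).
have := ler_distD (chart_dist 0 u v) (chart_dist s u v) (chart_dist s' u v); lra.
Qed.

Lemma arc_length_lip s s' : s <= s' ->
  arc_length s <= arc_length s' <= arc_length s + (s' - s).
Proof.
by move=> ss'; rewrite /arc_length; case: (leP s 0) => ?; case: (leP s' 0) => ?; lra.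
Qed.

Lemma dGH_gamma_le (p0 : X) s s' : - (1 / 2) <= s -> - (1 / 2) <= s' ->
  (dGH (gamma X s) (gamma X s') <= `|arc_length s - arc_length s'|%:E)%E.
Proof.
move=> s_ge s'_ge.
have [al alE al_surj] := gamma_chart p0 s_ge.
have [be beE be_surj] := gamma_chart p0 s'_ge.
apply: (dGH_le_distortion (0, p0) _ _ al_surj be_surj) => // u v.
rewrite alE beE; case: (leP s s') => [ss'|/ltW ss'].
  apply: le_trans (chart_dist_lip u v ss') _.
  by have := arc_length_lip ss'; abs_lra.
rewrite distrC; apply: le_trans (chart_dist_lip u v ss') _.
by have := arc_length_lip ss'; abs_lra.
Qed.

(** A map with distortion [c] from [R x s' X] to [Zt (1 / 2 + s)], whose gaps have
    length [- 2 s], satisfies [c >= s' - 2 s], twice the difference of arc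
    lengths. *)
Lemma dGH_gamma_ge (p0 : X) s s' : - (1 / 2) <= s -> s <= 0 -> 0 < s' <= 1 ->
  (forall e, 0 < e -> exists p q : X, 1 - e < mdist p q) ->
  ((arc_length s' - arc_length s)%:E <= dGH (gamma X s) (gamma X s'))%E.
Proof.
move=> s_ge s0 /andP[s'0 s'1] diam_ge1; apply/lee_addgt0Pr => e e0.
rewrite leNgt; apply/negP; rewrite -lteBrDr// -EFinB.
move=> /dGH_lt_map[f fE].
have [i iE [iZ _]] := gamma_nonpos_embedding s0.
have [be beE _] := gamma_pos_chart s'0.
have [p [q pq]] := diam_ge1 _ e0.
have cE : 2 * (arc_length s' - arc_length s - e) = s' - 2 * s - 2 * e.
  by rewrite /arc_length s0 leNgt s'0 /=; lra.
have := @distortion_to_Zt _ X (fun p q => s' * mdist p q) s'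
  (2 * (arc_length s' - arc_length s - e)) (1 / 2 + s) (fun u => i (f (be u))) p q.
rewrite cE => low.
suff : s' * mdist p q + (1 - 2 * (1 / 2 + s)) <= s' - 2 * s - 2 * e.
  have : s' * (1 - e) < s' * mdist p q by rewrite ltr_pM2l.
  have : s' * e <= e by rewrite ler_piMl// ltW.
  lra.
apply: low => [p' q'|p' q'||||u v].
- by rewrite mulr_ge0 ?mdist_ge0// ltW.
- by rewrite ler_piMr// ltW.
- by rewrite metric_sym.
- lra.
- by move=> u; apply: iZ.
- by rewrite iE -beE -cE; apply: fE.
Qed.
End gamma_charts.

(** * Calibrated curves *)

Lemma dGH_ge0 (R : realType) (Y Z : metricType R) : (0 <= dGH Y Z)%E.
Proof. by apply: le_ereal_inf_tmp => _ [r [r0 _] <-]; rewrite lee_fin. Qed.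

(** The upper bounds telescope along a partition to [phi b - phi a], which the
    lower bound at the ends makes equal to the distance. *)
Lemma shortest_GH_curve_calibrated (R : realType) (a b : R)
    (g : R -> metricType R) (phi : R -> R) : a < b ->
  (forall s, s \in `[a, b] -> [set: g s] !=set0) ->
  (forall s s', s <= s' -> phi s <= phi s' <= phi s + (s' - s)) ->
  (forall s s', s \in `[a, b] -> s' \in `[a, b] ->
    (dGH (g s) (g s') <= `|phi s - phi s'|%:E)%E) ->
  ((phi b - phi a)%:E <= dGH (g a) (g b))%E ->
  shortest_GH_curve a b g.
Proof.
move=> ab g0 phi_lip dGH_le dGH_ge.
have aab : a \in `[a, b] by rewrite in_itv /= lexx ltW.
have bab : b \in `[a, b] by rewrite in_itv /= lexx ltW.
have dGHab : dGH (g a) (g b) = (phi b - phi a)%:E.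
  apply/eqP; rewrite eq_le dGH_ge andbT; apply: le_trans (dGH_le _ _ aab bab) _.
  by rewrite distrC ger0_norm// subr_ge0; case/andP: (phi_lip _ _ (ltW ab)).
split.
- exact: ltW.
- move=> s sab; split; first exact: g0.
  apply: (@squeeze_cvge _ _ _ _ (fun=> 0%E) _ (fun u => `|s - u|%:E)).
  + near=> u; rewrite dGH_ge0 /=.
    have uab : u \in `[a, b] by near: u; apply: withinT.
    apply: le_trans (dGH_le _ _ sab uab) _; rewrite lee_fin.
    case: (leP s u) => [|/ltW] /[dup] ? /phi_lip; abs_lra.
  + exact: cvg_cst.
  + apply: cvg_within_filter; apply: cvg_EFin; first by near=> u.
    rewrite /comp /=.
    have -> : (0 : R) = `|s - s| by rewrite subrr normr0.
    by apply: cvg_norm; apply: cvgB; [exact: cvg_cst|exact: cvg_id].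
- by rewrite dGHab.
- rewrite dGHab; apply/eqP; rewrite eq_le; apply/andP; split; last first.
    rewrite -dGHab; apply: ereal_sup_ubound; exists [:: b].
      exact: itv_partition1.
    by rewrite /GH_variation /= big_nat1.
  apply: ge_ereal_sup => _ [p part <-]; rewrite /GH_variation.
  set F := nth b (a :: p).
  have stepF i : (i < size p)%N -> F i <= F i.+1.
    by move=> ip; apply/ltW; case: part => /(pathP b) /(_ _ ip).
  have Fab i : (i <= size p)%N -> F i \in `[a, b].
    move=> ip; rewrite in_itv /=.
    by rewrite (itv_partition_nth_ge _ part)// (itv_partition_nth_le _ part).
  apply: (@le_trans _ _ (\sum_(0 <= i < size p) (phi (F i.+1) - phi (F i))%:E)%E).
    rewrite !big_nat; apply: lee_sum => i /andP[_ ip].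
    apply: le_trans (dGH_le _ _ (Fab _ (ltnW ip)) (Fab _ ip)) _.
    rewrite distrC ger0_norm// subr_ge0.
    by case/andP: (phi_lip _ _ (stepF _ ip)).
  rewrite sumEFin telescope_sumr// /F (itv_partition_nth_size b part).
  by rewrite lexx.
Unshelve. all: by end_near.
Qed.

(** * The shortest curve through the line *)

Lemma isometric_gamma0 (R : realType) (X : metricType R) :
  isometric (gamma X 0) (R^o : metricType R).
Proof.
have [i iE [_ i_surj]] := gamma_nonpos_embedding X (lexx (0 : R)).
exists i => [|x y]; last by rewrite mdist_real iE.
split => // [x y _ _ ixy|y _].
  by apply: mdist_positivity; rewrite -iE ixy subrr normr0.
have [|x <-] := i_surj y; first by rewrite addr0 Zt_half.
by exists x.
Qed.

Lemma isometric_Rd0 (R : realType) (X : metricType R) :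
  isometric (Rd X 0) (R^o : metricType R).
Proof.
rewrite /Rd /dilate; case: pselect => [lt00|_].
  by exfalso; move: lt00; rewrite ltxx.
exists fst => [|x y]; last by rewrite [RHS]addr0.
by split => // [[x []] [y []] _ _ /= -> //|y _]; exists (y, tt).
Qed.

Unset Implicit Arguments.

Theorem theorem5 (R : realType) (X : metricType R)
  (bndX : metric_bounded X) (pcX : path_connected (R := R) X)
  (diamX : diameter X = 1%:E)
  (delta : R) (delta_gt0 : 0 < delta) (delta_lt : delta < 1 / 2) :
  [/\ shortest_GH_curve (- delta) delta (gamma X),
      0 \in `]- delta, delta[,
      Zt (1 / 2 : R) = [set: R^o],
      isometric (gamma X 0) (R^o : metricType R) &
      isometric (Rd X 0) (R^o : metricType R)].
Proof.
have [[p0 _] _] := pcX.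
have diam_le1 (p q : X) : mdist p q <= 1.
  rewrite -lee_fin -diamX; apply: ereal_sup_ubound.
  by exists (p, q).
have diam_ge1 e : 0 < e -> exists p q : X, 1 - e < mdist p q.
  move=> e0; have : ((1 - e)%:E < diameter X)%E by rewrite diamX lte_fin; lra.
  by move=> /ereal_sup_gt[_ [[p q] _ <-]]; rewrite lte_fin; exists p, q.
split.
- apply: (@shortest_GH_curve_calibrated _ _ _ _ (@arc_length R)).
  + lra.
  + move=> s; rewrite in_itv /= => ?.
    have [|al _ _] := @gamma_chart _ X p0 s; first by lra.
    by exists (al (0, p0)).
  + exact: arc_length_lip.
  + by move=> s s'; rewrite !in_itv /= => ? ?; apply: dGH_gamma_le => //; lra.
  + by apply: dGH_gamma_ge => //; lra.
- rewrite in_itv /=; lra.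
- exact: Zt_half.
- exact: isometric_gamma0.
- exact: isometric_Rd0.
Qed.
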